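(* Let $\zeta$ be a uniform binary substitution. Then for every $y\in X_\zeta$ and every $m,\ell\in\mathbb N$, \[ \lim_{\varepsilon\to0}\mathrm{DET}_\ell(y^{(m)},\infty,\varepsilon)=1 . \]
   Context: Alphabet $A=\{0,1\}$, $\Sigma=A^{\mathbb N_0}$ with metric $\rho(y,z)=2^{-\min\{i\ge0:\,y_i\ne z_i\}}$ ($y\ne z$), shift $\sigma$. A uniform binary substitution is a map $\zeta:A\to A^*$ with $|\zeta(0)|=|\zeta(1)|=q\ge2$, extended to words by concatenation; $\mathcal L_\zeta$ is the set of subwords of words $\zeta^k(a)$, $a\in A$, $k\ge1$; $X_\zeta=\{y\in\Sigma:y_0\dots y_{n-1}\in\mathcal L_\zeta\ \forall n\}$. For a sequence $z$ (over a finite alphabet, analogous metric and shift), $\varepsilon>0$, $n\ge2$: recurrence plot $R(z,n,\varepsilon)$ is the $n\times n$ matrix ($0\le i,j<n$) with entry $1$ iff $\rho(\sigma^iz,\sigma^jz)\le\varepsilon$. A line of length $\ell$ is $(i,j,\ell)$ with $0\le i,j\le n-\ell$, $i\ne j$, entries $(i+k,j+k)=1$ for $0\le k<\ell$, entry $(i-1,j-1)=0$ if $\min\{i,j\}>0$, entry $(i+\ell,j+\ell)=0$ if $\max\{i,j\}<n-\ell$. $N_\ell$ = number of lines of length exactly $\ell$, $\lambda_\ell=N_\ell/(n^2-n)$, $\mathrm{RR}_\ell=\sum_{l\ge\ell}l\lambda_l$, determinism $\mathrm{DET}_\ell=\mathrm{RR}_\ell/\mathrm{RR}_1$; $\mathrm{DET}_\ell(z,\infty,\varepsilon)$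 is the limit as $n\to\infty$ (it exists in the situation of the claim). Embedding: $y^{(m)}$ is the sequence over $A^m$ whose $j$-th letter is $y_j\dots y_{j+m-1}$. *)

(* Defs.v *)
From HB Require Import structures.
From mathcomp Require Import all_boot all_order all_algebra.
From mathcomp Require Import all_classical all_reals all_analysis.
Set Implicit Arguments. Unset Strict Implicit. Unset Printing Implicit Defensive.
Import Order.TTheory GRing.Theory Num.Theory numFieldNormedType.Exports.
Local Open Scope ring_scope.
Local Open Scope classical_set_scope.

(** Binary alphabet A = {0,1} is modelled by [bool] (false = 0, true = 1). *)

Definition subst_word (zeta : bool -> seq bool) (w : seq bool) : seq bool :=
  flatten (map zeta w).

Definition subst_iter (zeta : bool -> seq bool) (k : nat) (w : seq bool) :=
  iter k (subst_word zeta) w.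

Definition uniform_subst (zeta : bool -> seq bool) (q : nat) : Prop :=
  (2 <= q)%N /\ size (zeta false) = q /\ size (zeta true) = q.

Definition in_lang (zeta : bool -> seq bool) (w : seq bool) : Prop :=
  exists (a : bool) (k : nat), (1 <= k)%N /\ infix w (subst_iter zeta k [:: a]).

Definition in_subshift (zeta : bool -> seq bool) (y : nat -> bool) : Prop :=
  forall n : nat, in_lang zeta (mkseq y n).

Definition shift {T : Type} (i : nat) (z : nat -> T) : nat -> T := fun k => z (i + k)%N.

Definition rho (R : realType) {T : eqType} (u v : nat -> T) : R :=
  match pselect (exists i, (fun i => u i != v i) i) with
  | left h => (2%:R : R) ^- (ex_minn h)
  | right _ => 0
  end.

Definition embed (m : nat) (y : nat -> bool) : nat -> m.-tuple bool :=
  fun j => [tuple y (j + k)%N | k < m].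

Definition rp (R : realType) {T : eqType} (z : nat -> T) (eps : R) (i j : nat) : bool :=
  rho R (shift i z) (shift j z) <= eps.

Definition is_line (R : realType) {T : eqType} (z : nat -> T) (n : nat) (eps : R)
    (i j l : nat) : bool :=
  [&& (i <= n - l)%N, (j <= n - l)%N, i != j,
      [forall k : 'I_l, rp z eps (i + k)%N (j + k)%N],
      (0 < minn i j)%N ==> ~~ rp z eps i.-1 j.-1 &
      (maxn i j < n - l)%N ==> ~~ rp z eps (i + l)%N (j + l)%N].

Definition Nlines (R : realType) {T : eqType} (z : nat -> T) (n : nat) (eps : R)
    (l : nat) : nat :=
  #|[set ij : 'I_n * 'I_n | is_line z n eps ij.1 ij.2 l]|.

Definition lambda (R : realType) {T : eqType} (z : nat -> T) (n : nat) (eps : R)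
    (l : nat) : R :=
  (Nlines z n eps l)%:R / ((n ^ 2)%:R - n%:R).

(** RR_l = sum_{l' >= l} l' lambda_{l'} (lines have length at most n). *)
Definition RR (R : realType) {T : eqType} (z : nat -> T) (n : nat) (eps : R)
    (l : nat) : R :=
  \sum_(l <= l' < n.+1) l'%:R * lambda z n eps l'.

Definition DET (R : realType) {T : eqType} (l : nat) (z : nat -> T) (n : nat)
    (eps : R) : R :=
  RR z n eps l / RR z n eps 1.

Definition DETinf (R : realType) {T : eqType} (l : nat) (z : nat -> T) (eps : R) : R :=
  lim ((fun n => DET l z n eps) @ \oo).

(* Main.v *)
Require Import Defs.
From mathcomp Require Import all_classical all_reals all_analysis.
From mathcomp Require Import all_boot all_order all_algebra.
From mathcomp Require Import zify ring lra.

(** For [eps < 1] the recurrence plot of [embed m y] compares windows of [y] of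
    some length [K], and [K] tends to infinity as [eps] tends to [0].  Let [s k]
    be the limiting proportion of pairs of positions of [y] at which the same
    word of length [k] starts.  By inclusion-exclusion the number of lines of
    length [l] is a second difference of numbers of runs, so that, as the size
    of the plot grows, the determinism for lines of length at least [l + 1]
    tends to [((l + 1) * s (K + l) - l * s (K + l + 1)) / s K].  The same
    identity shows that [s] is convex.

    The limits [s k] exist because the number of occurrences of a word is an
    almost additive function on the language: the difference of its values on
    the two words [zeta^p(a)] is multiplied by at most [q - 1], up to a bounded
    error, when [p] increases by one, while lengths are multiplied by [q].  The
    only exceptions are the substitutions permuting the constant words, for
    which [y] is constant.

    Applying [zeta] to pairs of equal words gives [s (k + 1) <= q * s (q * k)].
    With the convexity of [s] this forces [s k - s (k + 1) = O(s k / k)], hence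
    [s (k + 1) / s k] tends to [1], and so does the determinism. *)

Set Implicit Arguments.
Unset Strict Implicit.
Unset Printing Implicit Defensive.
Import Order.TTheory GRing.Theory Num.Theory numFieldNormedType.Exports.

(** * Runs along the diagonals of a square matrix *)

Section Runs.
Variables (E : rel nat) (n : nat).

Definition is_run l i j :=
  [&& i + l <= n, j + l <= n & [forall k : 'I_l, E (i + k) (j + k)]].

Lemma is_runP l i j :
  reflect [/\ i + l <= n, j + l <= n & forall k, k < l -> E (i + k) (j + k)]
          (is_run l i j).
Proof.
apply: (iffP and3P) => -[il jl Erun]; split=> //; last first.
  by apply/forallP => k; apply: Erun.
by move=> k kl; have /forallP/(_ (Ordinal kl)) := Erun.
Qed.

Lemma is_run_recr l i j :
  is_run l.+1 i j = [&& is_run l i j, maxn i j + l < n & E (i + l) (j + l)].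
Proof.
apply/is_runP/and3P => [[il jl Erun]|[/is_runP[il jl Erun] max_l El]].
  split; [|lia|exact: Erun].
  by apply/is_runP; split=> [||k kl]; [lia..|apply: Erun; lia].
split; [lia..|move=> k]; rewrite ltnS leq_eqVlt => /predU1P[->//|].
exact: Erun.
Qed.

Lemma is_runW l i j : is_run l.+1 i j -> is_run l i j.
Proof. by rewrite is_run_recr => /andP[]. Qed.

Lemma is_run_recl l i j : is_run l.+1 i j = E i j && is_run l i.+1 j.+1.
Proof.
apply/is_runP/andP => [[il jl Erun]|[E0 /is_runP[il jl Erun]]].
  split; first by have := Erun 0 isT; rewrite !addn0.
  by apply/is_runP; split=> [||k kl]; [lia..|rewrite !addSnnS; apply: Erun].
split=> [||[_|k kl]]; [lia..|by rewrite !addn0|by rewrite -!addSnnS Erun].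
Qed.

Lemma is_run_shift r l l' i j :
  r + l' <= l -> is_run l i j -> is_run l' (i + r) (j + r).
Proof.
move=> rl /is_runP[il jl Erun]; apply/is_runP; split; [lia..|move=> k kl].
by rewrite -!addnA Erun //; lia.
Qed.

Definition runs l : {set 'I_n * 'I_n} :=
  [set ij : 'I_n * 'I_n | is_run l ij.1 ij.2].

Definition left_extended_runs l : {set 'I_n * 'I_n} :=
  [set ij : 'I_n * 'I_n | (0 < minn ij.1 ij.2) && is_run l ij.1.-1 ij.2.-1].

Definition is_maximal_run l i j :=
  [&& is_run l i j, (0 < minn i j) ==> ~~ E i.-1 j.-1
    & (maxn i j + l < n) ==> ~~ E (i + l) (j + l)].

Definition maximal_runs l : {set 'I_n * 'I_n} :=
  [set ij : 'I_n * 'I_n | is_maximal_run l ij.1 ij.2].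

Lemma runsS_sub l : runs l.+1 \subset runs l.
Proof. by apply/subsetP => -[i j]; rewrite !inE; apply: is_runW. Qed.

Lemma runs_eq0 l : n < l -> runs l = set0.
Proof.
by move=> nl; apply/setP => -[i j]; rewrite !inE; apply/is_runP => -[]; lia.
Qed.

Lemma card_left_extended_runs l : 1 < l -> #|left_extended_runs l| = #|runs l|.
Proof.
move=> l_gt1; pose succ (ij : 'I_n * 'I_n) := (ordS ij.1, ordS ij.2).
have succ_inj : injective succ.
  apply: (can_inj (g := fun ij => (ord_pred ij.1, ord_pred ij.2))) => -[i j].
  by rewrite /= !ordSK.
rewrite -[RHS](card_imset _ succ_inj); apply: eq_card => -[i j]; rewrite inE /=.
apply/andP/imsetP => [[ij_gt0 ij_run]|[[i' j']]].
  exists (ord_pred i, ord_pred j); last by rewrite /succ /= !ord_predK.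
  have pred_modn (k : 'I_n) : 0 < k -> (k + n).-1 %% n = k.-1.
    by case: k => -[|k] //= kn _; rewrite modnDr modn_small; lia.
  by rewrite inE /= !pred_modn; lia.
rewrite inE => /= ij_run [-> ->]; have /is_runP[il jl _] := ij_run.
by rewrite /= !modn_small //=; lia.
Qed.

Lemma maximal_runsE l :
  maximal_runs l = runs l :\: (runs l.+1 :|: left_extended_runs l.+1).
Proof.
apply/setP => -[i j]; rewrite !inE /= /is_maximal_run is_run_recr negb_or.
case: (boolP (is_run l i j)) => [ij_run|_] /=; last by rewrite andbF.
rewrite andbT [RHS]andbC; congr andb; last by case: (_ < n).
have [//|ij_gt0] := posnP (minn i j).
by rewrite is_run_recl !prednK ?ij_run ?andbT //=; lia.
Qed.

(* Inclusion-exclusion: a run of length [l] is not maximal if it extends to the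
   right or to the left; those extending both ways start one step after the
   runs of length [l.+2]. *)
Lemma card_maximal_runs l : 0 < l ->
  #|maximal_runs l| + 2 * #|runs l.+1| = #|runs l| + #|runs l.+2|.
Proof.
move=> l_gt0; set left := left_extended_runs l.+1.
have left_sub : left \subset runs l.
  apply/subsetP => -[i j]; rewrite !inE is_run_recl /= => /andP[ij_gt0].
  by rewrite !prednK ?(leq_trans ij_gt0) ?geq_minl ?geq_minr // => /andP[].
have both_extended : runs l.+1 :&: left = left_extended_runs l.+2.
  apply/setP => -[i j]; rewrite !inE /=.
  have [|ij_gt0] := posnP (minn i j); first by rewrite andbF.
  rewrite /= !(is_run_recl _ i.-1) !prednK; [|lia..].
  by rewrite andbCA [_ && is_run l i j]andb_idr; last exact: is_runW.
rewrite maximal_runsE -/left.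
have := cardsID (runs l.+1 :|: left) (runs l).
rewrite (setIidPr _) ?subUset ?runsS_sub // => <-.
have := cardsUI (runs l.+1) left.
by rewrite both_extended !card_left_extended_runs //; lia.
Qed.

Lemma card_runs_convex l : 0 < l ->
  2 * #|runs l.+1| <= #|runs l| + #|runs l.+2|.
Proof. by move=> l_gt0; rewrite -card_maximal_runs // leq_addl. Qed.

Lemma sum_length_maximal_runs l : 0 < l ->
  \sum_(l <= k < n.+1) k * #|maximal_runs k| + l.-1 * #|runs l.+1| =
  l * #|runs l|.
Proof.
have [d] := ubnP (n.+1 - l); elim: d l => // d IH [//|l] n_l _ /=.
have [nl|ln] := ltnP n l.+1.
  by rewrite big_geq // !runs_eq0 ?cards0 ?muln0 //; lia.
rewrite big_ltn //=.
have := card_maximal_runs (ltn0Sn l); have := IH l.+2 ltac:(lia) isT.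
move=> /=; set tail := \sum_(_ <= _ < _) _; nia.
Qed.

End Runs.

Lemma eq_runs (E E' : rel nat) n l : E =2 E' -> runs E n l = runs E' n l.
Proof.
move=> eqE; apply/setP => ij; rewrite !inE; congr [&& _, _ & _].
by apply: eq_forallb => k; rewrite eqE.
Qed.

Lemma eq_card_runs (E E' : rel nat) n n' l l' : 0 < l -> n <= n' ->
  (forall i j, is_run E n l i j = is_run E' n' l' i j) ->
  #|runs E n l| = #|runs E' n' l'|.
Proof.
move=> l_gt0 nn' eq_run; pose widen := widen_ord nn'.
have widen_inj : injective (fun ij : 'I_n * 'I_n => (widen ij.1, widen ij.2)).
  by move=> [i j] [i' j'] [eq_i eq_j]; congr pair; apply: val_inj.
rewrite -[LHS](card_imset _ widen_inj); apply: eq_card => -[i j].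
rewrite [RHS]inE -eq_run /=; apply/imsetP/idP => [[[i' j']]|ij_run].
  by rewrite inE => ij_run [-> ->].
have /is_runP[il jl _] := ij_run.
have i_n : i < n by lia.
have j_n : j < n by lia.
exists (Ordinal i_n, Ordinal j_n); first by rewrite inE.
by congr pair; apply: val_inj.
Qed.

Definition offdiag (E : rel nat) : rel nat := fun i j => (i != j) && E i j.

Lemma is_run_offdiag E n l i j : 0 < l ->
  is_run (offdiag E) n l i j = (i != j) && is_run E n l i j.
Proof.
move=> l_gt0; apply/is_runP/andP => [[il jl Erun]|[ij /is_runP[il jl Erun]]].
  split; first by have /andP[] := Erun 0 l_gt0; rewrite !addn0.
  by apply/is_runP; split=> // k /Erun/andP[].
by split=> // k kl; rewrite /offdiag eqn_add2r ij Erun.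
Qed.

Lemma card_ord_ltn n m : m <= n -> #|[set i : 'I_n | i < m]| = m.
Proof.
move=> mn; rewrite -[RHS]card_ord -!sum1_card (big_ord_widen n (fun=> 1)) //.
by apply: eq_bigl => i; rewrite inE.
Qed.

Lemma card_runs_offdiag (E : rel nat) n l : 0 < l -> reflexive E ->
  #|runs (offdiag E) n l| + (n.+1 - l) = #|runs E n l|.
Proof.
move=> l_gt0 Exx; pose diag (i : 'I_n) := (i, i).
have diag_inj : injective diag by move=> i j [].
have in_diag i j : ((i, j) \in diag @: setT) = (i == j).
  by apply/imsetP/eqP => [[k _ [-> ->]]|->]; last exists j.
rewrite -(cardsID (diag @: setT) (runs E n l)) addnC; congr addn; last first.
  by apply: eq_card => -[i j]; rewrite in_setD in_diag !inE is_run_offdiag.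
have -> : runs E n l :&: diag @: setT = diag @: [set i : 'I_n | i < n.+1 - l].
  apply/setP => -[i j]; rewrite in_setI in_diag inE /=; apply/andP/imsetP.
    by case=> /is_runP[il _ _] /eqP <-; exists i; rewrite // inE; lia.
  case=> k; rewrite inE => k_l [-> ->]; split=> //.
  by apply/is_runP; split=> //; lia.
by rewrite card_imset // card_ord_ltn //; lia.
Qed.

(** * Occurrences and recurrences in words *)

Definition agree (T : eqType) (y : nat -> T) : rel nat := fun i j => y i == y j.

Definition occ (T : eqType) (w x : seq T) : nat :=
  \sum_(i < size x) prefix w (drop i x).

Definition factor (T : Type) (x : seq T) (k i : nat) : seq T :=
  take k (drop i x).

Definition recurrences (T : eqType) (x : seq T) (k : nat) : nat :=
  #|runs (agree (onth x)) (size x) k|.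

Section Occurrences.
Variable T : eqType.
Implicit Types w x : seq T.

Lemma occ_cons w a x : occ w (a :: x) = prefix w (a :: x) + occ w x.
Proof. by rewrite /occ big_ord_recl. Qed.

Lemma occ_le_size w x : occ w x <= size x.
Proof.
rewrite -[leqRHS]card_ord -sum1_card; apply: leq_sum => i _; exact: leq_b1.
Qed.

Lemma occ_cat_ge w x x' : occ w x + occ w x' <= occ w (x ++ x').
Proof.
elim: x => [|a x IH]; first by rewrite /occ big_ord0.
rewrite cat_cons !occ_cons -addnA leq_add // -cat_cons.
by case w_pre: (prefix w (a :: x)) => //; rewrite prefix_catl.
Qed.

(* The occurrences missing on the right cross the junction, and thus start in
   the last [size w] letters of [x]. *)
Lemma occ_cat_le w x x' : occ w (x ++ x') <= occ w x + occ w x' + size w.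
Proof.
suff: occ w (x ++ x') <= occ w x + occ w x' + minn (size x) (size w).
  by move/leq_trans; apply; rewrite leq_add2l geq_minr.
elim: x => [|a x IH]; first by rewrite /occ big_ord0 min0n addn0.
rewrite cat_cons !occ_cons -cat_cons.
have [w_short|w_long] := leqP (size w) (size (a :: x)); last first.
  by move: w_long IH (leq_b1 (prefix w ((a :: x) ++ x'))) => /=; lia.
have -> : prefix w ((a :: x) ++ x') = prefix w (a :: x).
  by rewrite !prefixE takel_cat.
by move: w_short IH => /=; lia.
Qed.

Lemma size_factor x k i : i < size x ->
  (size (factor x k i) == k) = (i + k <= size x).
Proof. by rewrite size_take_min size_drop; lia. Qed.

Lemma onth_factor x k i t :
  onth (factor x k i) t = if t < k then onth x (i + t) else None.
Proof.
rewrite !onthE map_take map_drop; case: ltnP => tk.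
  by rewrite nth_take ?nth_drop.
by rewrite nth_default // size_take_min geq_min tk.
Qed.

Lemma is_run_onth x k i j : is_run (agree (onth x)) (size x) k i j =
  [&& i + k <= size x, j + k <= size x & factor x k i == factor x k j].
Proof.
congr [&& _, _ & _]; apply/forallP/eqP => [agree_ij|eq_ij t].
  apply: eq_from_onth => t; rewrite !onth_factor; case: ltnP => // tk.
  by have /eqP := agree_ij (Ordinal tk).
have := congr1 (fun s => onth s t) eq_ij.
by rewrite /= !onth_factor ltn_ord => /eqP.
Qed.

Lemma is_run_mkseq (y : nat -> T) n l i j :
  is_run (agree (onth (mkseq y n))) (size (mkseq y n)) l i j =
  is_run (agree y) n l i j.
Proof.
rewrite size_mkseq; apply/is_runP/is_runP => -[il jl agree_ij]; split=> // t tl;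
  have := agree_ij t tl; rewrite /agree !onthE !(nth_map (y 0)) ?size_mkseq;
  rewrite ?nth_mkseq //; lia.
Qed.

End Occurrences.

Section FiniteAlphabet.
Variable T : finType.
Implicit Types w x s : seq T.

Lemma sum_eq_tuple k s : \sum_(w : k.-tuple T) (s == w) = (size s == k).
Proof.
case: eqP => [size_s|size_s]; last first.
  by rewrite big1 // => w _; case: eqP size_s => // ->; rewrite size_tuple.
rewrite (bigD1 (Tuple (introT eqP size_s))) //= eqxx big1 // => w.
by rewrite -val_eqE eq_sym /= => /negPf ->.
Qed.

Lemma sum_occ k x : 0 < k ->
  \sum_(w : k.-tuple T) occ w x = (size x).+1 - k.
Proof.
move=> k_gt0; rewrite exchange_big /= -[RHS](card_ord_ltn (n := size x)).
  rewrite -sum1_card [RHS]big_mkcond; apply: eq_bigr => i _ /=.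
  under eq_bigr => w _ do rewrite prefixE size_tuple -/(factor x k i).
  rewrite sum_eq_tuple size_factor // inE.
  by rewrite (_ : (i < _) = (i + k <= size x)); [case: leqP|lia].
lia.
Qed.

Lemma recurrencesE x k : recurrences x k = \sum_(w : k.-tuple T) occ w x ^ 2.
Proof.
rewrite /recurrences -sum1_card big_mkcond /=.
under [RHS]eq_bigr => w _ do rewrite -mulnn /occ big_distrlr pair_bigA /=.
rewrite exchange_big; apply: eq_bigr => -[i j] _ /=.
transitivity (\sum_(w : k.-tuple T)
    (factor x k i == factor x k j) * (factor x k i == w)); last first.
  apply: eq_bigr => w _; rewrite !prefixE size_tuple -!/(factor x k _).
  by case: (factor x k i =P w) => [->|]; rewrite ?muln0 ?mul1n ?muln1 1?eq_sym.
rewrite -big_distrr /= sum_eq_tuple inE is_run_onth /=.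
have [eq_ij|] := eqVneq (factor x k i) (factor x k j).
  have := congr1 (fun s => size s == k) eq_ij; rewrite !size_factor // => ->.
  by rewrite andbT andbb mul1n; case: leqP.
by rewrite !andbF mul0n.
Qed.

End FiniteAlphabet.

(** * Images of words under uniform substitutions *)

Section UniformBlocks.
Variables (S T : eqType) (f : S -> seq T) (q : nat).
Hypothesis size_f : forall a, size (f a) = q.
Implicit Types (u v : seq S) (x : seq T).

Lemma size_flatten_map u : size (flatten (map f u)) = size u * q.
Proof. by elim: u => //= a u IH; rewrite size_cat IH size_f mulSn. Qed.

Lemma onth_flatten_map u i r : r < q ->
  onth (flatten (map f u)) (i * q + r) =
  obind (fun a => onth (f a) r) (onth u i).
Proof.
move=> rq; elim: u i => [|a u IH] i /=; first by rewrite !onth0n.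
case: i => [|i] /=; first by rewrite onth_cat size_f rq.
by rewrite onth_cat size_f mulSn -addnA ltnNge leq_addr /= addKn IH.
Qed.

Lemma is_run_flatten_map u l i j : is_run (agree (onth u)) (size u) l i j ->
  is_run (agree (onth (flatten (map f u)))) (size (flatten (map f u)))
    (l * q) (i * q) (j * q).
Proof.
move=> /is_runP[il jl agree_ij]; apply/is_runP; rewrite size_flatten_map.
rewrite -!mulnDl !leq_mul2r il jl !orbT; split=> // t tlq.
have q_gt0 : 0 < q by case: (q) tlq; rewrite ?muln0.
rewrite /agree (divn_eq t q) !addnA -!mulnDl !onth_flatten_map ?ltn_pmod //.
by rewrite (eqP (agree_ij _ _)) // ltn_divLR.
Qed.

(* Each recurrence in [u] counts [q] times in the image of [u], once for every
   offset in the first block. *)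
Lemma recurrences_flatten_map u k :
  q * recurrences u k.+1 <= recurrences (flatten (map f u)) (k * q).
Proof.
pose N := size (flatten (map f u)).
have pos_lt (i : 'I_(size u)) (r : 'I_q) : i * q + r < N.
  by rewrite /N size_flatten_map; have := ltn_ord i; have := ltn_ord r; nia.
pose pos (t : 'I_q * ('I_(size u) * 'I_(size u))) : 'I_N * 'I_N :=
  (Ordinal (pos_lt t.2.1 t.1), Ordinal (pos_lt t.2.2 t.1)).
have pos_inj : injective pos.
  move=> [r [i j]] [r' [i' j']] [eq_i eq_j].
  have q_gt0 : 0 < q by apply: leq_ltn_trans (ltn_ord r).
  have eq_r : r = r' :> nat.
    by have := congr1 (modn^~ q) eq_i; rewrite !modnMDl !modn_small.
  congr (_, (_, _)); apply: val_inj => //=; apply/eqP;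
    rewrite -(eqn_pmul2r q_gt0); apply/eqP; lia.
rewrite /recurrences -[X in X * _](card_ord q) -cardsT -cardsX.
rewrite -(card_imset _ pos_inj); apply: subset_leq_card; apply/subsetP => ij.
case/imsetP => -[r [i j]]; rewrite in_setX !inE /= => ij_run ->.
apply: is_run_shift (is_run_flatten_map ij_run) => /=.
by have := ltn_ord r; lia.
Qed.

Lemma prefix_flatten_map x v : prefix x (flatten (map f v)) ->
  exists v' x', x = flatten (map f v') ++ x' /\ size x' <= q.
Proof.
elim: v x => [|a v IH] x.
  by rewrite prefixs0 => /eqP ->; exists [::], [::].
have [xq|qx] := leqP (size x) q; first by exists [::], x.
rewrite /= -{1}(cat_take_drop q x).
rewrite prefix_catr ?size_takel ?size_f ?(ltnW qx) //.
case/andP => /eqP eq_take /IH[v' [x' [eq_drop x'_le]]].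
exists (a :: v'), x'; split=> //.
by rewrite /= -catA -eq_drop -eq_take cat_take_drop.
Qed.

Lemma drop_flatten_map i v :
  exists s v',
    drop i (flatten (map f v)) = s ++ flatten (map f v') /\ size s <= q.
Proof.
elim: v i => [|a v IH] i; first by exists [::], [::].
rewrite /= drop_cat size_f; case: ltnP => _; last exact: IH.
by exists (drop i (f a)), v; rewrite size_drop size_f leq_subr.
Qed.

Lemma infix_flatten_map x v : infix x (flatten (map f v)) ->
  exists s v' s',
    [/\ x = s ++ flatten (map f v') ++ s', size s <= q & size s' <= q].
Proof.
case/infixP => t [t' eq_image].
have [s [v' [eq_drop s_le]]] := drop_flatten_map (size t) v.
have : prefix x (s ++ flatten (map f v')).
  by rewrite -eq_drop eq_image drop_size_cat // prefix_prefix.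
have [xs _|sx] := leqP (size x) (size s).
  by exists x, [::], [::]; split; rewrite ?cats0 ?(leq_trans xs).
rewrite -{1}(cat_take_drop (size s) x) prefix_catr ?size_takel ?(ltnW sx) //.
case/andP => /eqP eq_take /prefix_flatten_map[w [s' [eq_x s'_le]]].
by exists s, w, s'; rewrite -eq_x -{1}eq_take cat_take_drop.
Qed.

End UniformBlocks.

Section SubstitutionIterates.
Variables (zeta : bool -> seq bool) (q : nat).
Hypotheses (q_gt1 : 1 < q) (size_zeta : forall b, size (zeta b) = q).

Lemma subst_iter_letters p v :
  subst_iter zeta p v = flatten [seq subst_iter zeta p [:: b] | b <- v].
Proof.
have subst_iter_cat u u' :
    subst_iter zeta p (u ++ u') = subst_iter zeta p u ++ subst_iter zeta p u'.
  elim: p => //= p; rewrite /subst_iter /= => ->.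
  by rewrite /subst_word map_cat flatten_cat.
elim: v => [|b v IH]; first by elim: (p) => // r; rewrite /subst_iter /= => ->.
by rewrite -cat1s subst_iter_cat IH.
Qed.

Lemma subst_iterSr p b :
  subst_iter zeta p.+1 [:: b] = subst_iter zeta p (zeta b).
Proof. by rewrite /subst_iter iterSr /subst_word /= cats0. Qed.

Lemma size_subst_iter p u : size (subst_iter zeta p u) = size u * q ^ p.
Proof.
elim: p => [|p IH]; first by rewrite muln1.
by rewrite /subst_iter /= (size_flatten_map size_zeta) IH expnSr mulnA.
Qed.

Lemma size_block p b : size (subst_iter zeta p [:: b]) = q ^ p.
Proof. by rewrite size_subst_iter mul1n. Qed.

Lemma in_lang_subst_iter p b : 0 < p -> in_lang zeta (subst_iter zeta p [:: b]).
Proof. by move=> p_gt0; exists b, p; rewrite infix_refl. Qed.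

Lemma in_lang_decomposition p x : in_lang zeta x -> q ^ p < size x ->
  exists s v s', [/\ x = s ++ subst_iter zeta p v ++ s',
    size s <= q ^ p & size s' <= q ^ p].
Proof.
case=> b [k [_ x_infix]] x_long.
have pk : p <= k.
  rewrite leqNgt; apply/negP => kp.
  have := leq_trans x_long (size_infix x_infix); rewrite size_block.
  by rewrite ltnNge leq_pexp2l // ltnW.
have eq_iter : subst_iter zeta k [:: b] =
    subst_iter zeta p (subst_iter zeta (k - p) [:: b]).
  by rewrite /subst_iter -iterD subnKC.
move: x_infix; rewrite eq_iter subst_iter_letters.
case/(infix_flatten_map (size_block p)) => s [v [s' [eq_x s_le s'_le]]].
by exists s, v, s'; rewrite subst_iter_letters.
Qed.

End SubstitutionIterates.

(** * Recurrences of the embedded sequence *)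

Lemma embed_eqP m (y : nat -> bool) i j :
  reflect (forall t, t < m -> y (i + t) = y (j + t))
          (embed m y i == embed m y j).
Proof.
apply: (iffP eqP) => [eq_ij t tm|eq_ij].
  by have := congr1 (fun w => tnth w (Ordinal tm)) eq_ij; rewrite !tnth_mktuple.
by apply: eq_from_tnth => t; rewrite !tnth_mktuple eq_ij.
Qed.

Lemma is_run_embed K y n l i j :
  is_run (agree (embed K.+1 y)) n l.+1 i j =
  is_run (agree y) (n + K) (K + l).+1 i j.
Proof.
apply/is_runP/is_runP => -[il jl agree_ij]; split; try lia; move=> t tl.
  have /embed_eqP/(_ (minn t K) ltac:(lia)) := agree_ij (t - K) ltac:(lia).
  by move/eqP; rewrite -!addnA (_ : _ + minn t K = t) //; lia.
by apply/embed_eqP => r rK; rewrite -!addnA; apply/eqP/agree_ij; lia.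
Qed.

Lemma card_runs_embed K y n l :
  #|runs (agree (embed K.+1 y)) n l.+1| =
  recurrences (mkseq y (n + K)) (K + l).+1.
Proof.
apply: eq_card_runs => // [|i j]; first by rewrite size_mkseq leq_addr.
by rewrite is_run_mkseq is_run_embed.
Qed.

Local Open Scope ring_scope.
Local Open Scope classical_set_scope.

(** * Convergence of real sequences *)

Lemma cvg_natV (R : realType) : (n%:R^-1 : R) @[n --> \oo] --> 0.
Proof.
apply/gtr0_cvgV0; last exact: cvgr_idn.
by exists 1%N => // n /= n_gt0; rewrite ltr0n.
Qed.

Lemma cvg_contraction (R : archiRealFieldType) (u v : R^nat) (r : R) :
  0 <= r < 1 -> (forall n, 0 <= u n) -> (forall n, u n.+1 <= r * u n + v n) ->
  v @ \oo --> 0 -> u @ \oo --> 0.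
Proof.
move=> /andP[r_ge0 r_lt1] u_ge0 u_rec v_cvg0; apply/cvgr0Pnorm_le => e e_gt0.
have d_gt0 : 0 < (1 - r) * (e / 2) by apply: mulr_gt0; lra.
have /cvgr0Pnorm_le/(_ _ d_gt0)[N _ v_small] := v_cvg0.
have u_bound j : u (N + j)%N <= u N * r ^+ j + e / 2.
  elim: j => [|j IH]; first by rewrite addn0 expr0 mulr1; lra.
  have /ler_normlW := v_small (N + j)%N (leq_addr _ _).
  have := ler_wpM2l r_ge0 IH; have := u_rec (N + j)%N.
  by rewrite addnS exprS mulrDr mulrCA; lra.
have norm_r_lt1 : `|r| < 1 by rewrite ger0_norm.
have e2_gt0 : 0 < e / 2 by lra.
have /cvgr0Pnorm_le/(_ _ e2_gt0)[M _ geom_small] :=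
  cvg_geometric (u N) norm_r_lt1.
exists (N + M)%N => // n /= NMn; rewrite ger0_norm //.
have /ler_normlW := geom_small (n - N)%N ltac:(rewrite /=; lia).
by have := u_bound (n - N)%N; rewrite subnKC /=; [lra|lia].
Qed.

Lemma cvg_ratio_shift (R : numFieldType) (s : R^nat) l : (forall n, s n != 0) ->
  s n.+1 / s n @[n --> \oo] --> (1 : R) ->
  s (n + l)%N / s n @[n --> \oo] --> (1 : R).
Proof.
move=> s_neq0 s_ratio; elim: l => [|l IH].
  by apply: cvg_near_cst; apply: nearW => n; rewrite addn0 divff.
have s_ratio_l : s (n + l).+1 / s (n + l)%N @[n --> \oo] --> (1 : R).
  by have := s_ratio; rewrite -(cvg_shiftn l).
rewrite -[1 in X in _ --> X]mulr1; apply: cvg_trans (cvgM s_ratio_l IH).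
by apply: near_eq_cvg; apply: nearW => n /=; rewrite addnS mulrA divfK.
Qed.

Section ConvexDoubling.
Variables (R : archiRealFieldType) (t : R^nat) (C : R).
Hypothesis t_gt0 : forall n, 0 < t n.
Hypothesis t_decr : nonincreasing_seq t.
Hypothesis t_convex : nonincreasing_seq (fun n => t n - t n.+1).
Hypothesis t_doubling : forall n, t n.+1 <= C * t n.*2.+1.

(* Convexity spreads the decrement at [n] over [n./2 < k <= n], where [t] is
   bounded by a multiple of [t n]. *)
Lemma convex_doubling_decrement n : (uphalf n)%:R * (t n - t n.+1) <= C * t n.
Proof.
have C_gt0 : 0 < C.
  by have := t_doubling 0; have := t_gt0 1; rewrite /=; nra.
case: n => [|n]; first by rewrite mul0r mulr_ge0 // ltW.
have half_le : ((n.+1)./2.+1 <= n.+2)%N by lia.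
have spread : (uphalf n.+1)%:R * (t n.+1 - t n.+2) <= t (n.+1)./2.+1 - t n.+2.
  rewrite -[leRHS]opprB -telescope_sumr // -sumrN.
  have -> : uphalf n.+1 = (n.+2 - (n.+1)./2.+1)%N by lia.
  rewrite mulr_natl -sumr_const_nat; apply: ler_sum_nat => k /andP[_ kn].
  by rewrite opprB; apply: t_convex.
have := t_doubling (n.+1)./2; have := t_gt0 n.+2.
have : C * t (n.+1)./2.*2.+1 <= C * t n.+1.
  by apply: ler_wpM2l; [exact: ltW|apply: t_decr; lia].
lra.
Qed.

Lemma cvg_convex_doubling_ratio : t n.+1 / t n @[n --> \oo] --> (1 : R).
Proof.
rewrite -cvg_shiftS.
have lower_cvg : 1 - 2 * C * harmonic n @[n --> \oo] --> (1 : R).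
  rewrite -[X in _ --> X]subr0 -(mulr0 (2 * C)).
  by apply: cvgB; [exact: cvg_cst|apply: cvgMr; exact: cvg_harmonic].
apply: (squeeze_cvgr _ lower_cvg (cvg_cst (1 : R))); apply: nearW => n /=.
rewrite ler_pdivlMr // ler_pdivrMr // mul1r t_decr // andbT.
rewrite mulrBl mul1r lerBlDr -lerBlDl mulrAC ler_pdivlMr ?ltr0n //.
have decr : t n.+2 <= t n.+1 by exact: t_decr.
have : n.+1%:R <= 2 * (uphalf n.+1)%:R :> R by rewrite -natrM ler_nat; lia.
have := convex_doubling_decrement n.+1; nra.
Qed.

End ConvexDoubling.

(** * Frequencies in the language of a substitution *)

Section AlmostAdditive.
Variables (R : realFieldType) (T : Type) (F : seq T -> R) (c : R).
Hypothesis F_le_size : forall x, `|F x| <= (size x)%:R.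
Hypothesis F_cat : forall x x', `|F (x ++ x') - (F x + F x')| <= c.

Lemma almost_additive_nil : F [::] = 0.
Proof. by apply/eqP; rewrite -normr_le0 (F_le_size [::]). Qed.

Lemma almost_additive_flatten (S : Type) (f : S -> seq T) v :
  `|F (flatten (map f v)) - \sum_(b <- v) F (f b)| <= c * (size v)%:R.
Proof.
elim: v => [|b v IH].
  by rewrite big_nil almost_additive_nil subrr normr0 mulr0.
rewrite big_cons /= -natr1 -[c]mulr1.
have := F_cat (f b) (flatten (map f v)); move: IH; rewrite !ler_norml; lra.
Qed.

Lemma almost_additive_trim s x s' :
  `|F (s ++ x ++ s') - F x| <= 2 * c + (size s)%:R + (size s')%:R.
Proof.
have := F_cat s (x ++ s'); have := F_cat x s'.
by have := F_le_size s; have := F_le_size s'; rewrite !ler_norml; lra.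
Qed.

End AlmostAdditive.

Lemma sum_letters (R : comNzRingType) (g : bool -> R) v :
  \sum_(b <- v) g b =
  (size v)%:R * g false + (count_mem true v)%:R * (g true - g false).
Proof.
elim: v => [|b v IH]; first by rewrite big_nil !mul0r addr0.
by rewrite big_cons IH /= -natr1 natrD; case: b => /=; ring.
Qed.

Definition long_words (zeta : bool -> seq bool) : set_system (seq bool) :=
  [set A | exists N, forall x, in_lang zeta x -> (N <= size x)%N -> A x].

(* The difference of the two counts is the second eigenvalue of the incidence
   matrix of [zeta], the first one being [q]. *)
Definition contracting (zeta : bool -> seq bool) (q : nat) : bool :=
  (`|count_mem true (zeta true) - count_mem true (zeta false)| < q)%N.

Section Substitution.
Variables (zeta : bool -> seq bool) (q : nat).
Hypotheses (q_gt1 : (1 < q)%N) (size_zeta : forall b, size (zeta b) = q).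

#[local] Instance long_words_filter : ProperFilter (long_words zeta).
Proof.
split.
  move=> [N lang_empty]; apply: (lang_empty (subst_iter zeta N.+1 [:: false])).
    exact: in_lang_subst_iter.
  by rewrite (size_block size_zeta) ltnW // ltnW // ltn_expl.
split; first by exists 0%N.
- move=> A A' [N AN] [N' AN']; exists (maxn N N') => x x_lang.
  by rewrite geq_max => /andP[Nx N'x]; split; [exact: AN|exact: AN'].
- by move=> A A' AA' [N AN]; exists N => x x_lang Nx; apply/AA'/AN.
Qed.

Lemma cvg_size_long_words : size x @[x --> long_words zeta] --> \oo.
Proof. by apply/cvgnyPge => N; exists N. Qed.

Lemma cvg_prefix_long_words y : in_subshift zeta y ->
  mkseq y n @[n --> \oo] --> long_words zeta.
Proof.
move=> y_lang A [N AN]; exists N => // n /= Nn; apply: AN; first exact: y_lang.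
by rewrite size_mkseq.
Qed.

Lemma cvg_subst_iter_long_words :
  subst_iter zeta p [:: false] @[p --> \oo] --> long_words zeta.
Proof.
move=> A [N AN]; exists N.+1 => // p /= Np; apply: AN.
  by apply: in_lang_subst_iter; case: p Np.
rewrite (size_block size_zeta) (leq_trans (ltnW Np)) // ltnW //.
exact: ltn_expl.
Qed.

Section WordStatistic.
Variables (R : realType) (F : seq bool -> R) (c : R).
Hypothesis F_le_size : forall x, `|F x| <= (size x)%:R.
Hypothesis F_cat : forall x x', `|F (x ++ x') - (F x + F x')| <= c.

Let c_ge0 : 0 <= c. Proof. exact: le_trans (F_cat [::] [::]). Qed.
Let q_gt0 : 0 < q%:R :> R. Proof. by rewrite ltr0n ltnW. Qed.
Let qX_gt0 p : 0 < (q ^ p)%:R :> R. Proof. by rewrite natrX exprn_gt0. Qed.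

Let qXV_cvg0 : (q ^ p)%:R^-1 @[p --> \oo] --> (0 : R).
Proof.
have qV_lt1 : `|q%:R^-1 : R| < 1.
  by rewrite ger0_norm ?invr_ge0 ?(ltW q_gt0) // invf_lt1 // ltr1n.
by under eq_fun do rewrite natrX -exprVn; exact: cvg_expr.
Qed.

Definition block_mean p : R :=
  F (subst_iter zeta p [:: false]) / (q ^ p)%:R.

Definition discrepancy p : R :=
  F (subst_iter zeta p [:: true]) - F (subst_iter zeta p [:: false]).

Lemma almost_additive_subst_iter p v :
  `|F (subst_iter zeta p v) - ((size v)%:R * F (subst_iter zeta p [:: false]) +
      (count_mem true v)%:R * discrepancy p)| <= c * (size v)%:R.
Proof.
rewrite subst_iter_letters.
rewrite -(sum_letters (fun b => F (subst_iter zeta p [:: b]))).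
exact: almost_additive_flatten.
Qed.

Lemma discrepancyS p : contracting zeta q ->
  `|discrepancy p.+1| <= (q%:R - 1) * `|discrepancy p| + 2 * c * q%:R.
Proof.
rewrite /contracting => contr.
pose count b := count_mem true (zeta b).
have count_le : `|((count true)%:R - (count false)%:R) * discrepancy p| <=
    (q%:R - 1) * `|discrepancy p|.
  rewrite normrM ler_wpM2r // lerBrDr.
  suff -> : `|(count true)%:R - (count false)%:R : R| =
      `|count true - count false|%N%:R by rewrite natr1 ler_nat.
  by rewrite natr_absz intr_norm intrB.
have := almost_additive_subst_iter p (zeta true).
have := almost_additive_subst_iter p (zeta false).
rewrite -!subst_iterSr !size_zeta; move: count_le.
rewrite [discrepancy p.+1]/discrepancy /count !ler_norml; lra.
Qed.

Lemma cvg_discrepancy : contracting zeta q ->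
  `|discrepancy p| / (q ^ p)%:R @[p --> \oo] --> (0 : R).
Proof.
move=> contr; pose r : R := (q%:R - 1) / q%:R.
have r01 : 0 <= r < 1.
  rewrite /r ltr_pdivrMr // mul1r ltrBlDr ltrDl ltr01 andbT.
  by rewrite divr_ge0 ?(ltW q_gt0) // subr_ge0 ler1n ltnW.
have forcing_cvg0 : 2 * c / (q ^ p)%:R @[p --> \oo] --> (0 : R).
  by rewrite -(mulr0 (2 * c)); apply: cvgMr qXV_cvg0.
apply: (cvg_contraction r01 _ _ forcing_cvg0) => p; first by rewrite divr_ge0.
rewrite ler_pdivrMr // [leRHS](_ : _ =
  (q%:R - 1) * `|discrepancy p| + 2 * c * q%:R) ?discrepancyS //.
by rewrite expnS natrM /r; field; rewrite !gt_eqF.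
Qed.

Lemma block_mean_le1 p : `|block_mean p| <= 1.
Proof.
rewrite normrM normfV normr_nat ler_pdivrMr // mul1r.
rewrite -(size_block size_zeta p false); exact: F_le_size.
Qed.

Lemma almost_additive_blocks p s v s' (x := s ++ subst_iter zeta p v ++ s') :
  `|F x - (size x)%:R * block_mean p| <= 2 * c + 2 * (size s)%:R +
    2 * (size s')%:R + (size v)%:R * (`|discrepancy p| + c).
Proof.
have F_trim := almost_additive_trim F_le_size F_cat s (subst_iter zeta p v) s'.
have F_blocks : `|F (subst_iter zeta p v) - (size v)%:R *
    F (subst_iter zeta p [:: false])| <= (size v)%:R * (`|discrepancy p| + c).
  have count_le :
      `|(count_mem true v)%:R * discrepancy p| <=
      (size v)%:R * `|discrepancy p|.
    by rewrite normrM normr_nat ler_wpM2r // ler_nat count_size.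
  have := almost_additive_subst_iter p v.
  by move: count_le; rewrite !ler_norml; lra.
have mean_trim : `|(size x)%:R * block_mean p -
    (size v)%:R * F (subst_iter zeta p [:: false])| <=
    (size s)%:R + (size s')%:R.
  have -> : (size x)%:R * block_mean p -
      (size v)%:R * F (subst_iter zeta p [:: false]) =
      ((size s)%:R + (size s')%:R) * block_mean p.
    rewrite !size_cat (size_subst_iter size_zeta) !natrD natrM /block_mean.
    by field; rewrite gt_eqF.
  rewrite normrM ger0_norm ?addr_ge0 // ler_piMr ?addr_ge0 //.
  exact: block_mean_le1.
by move: F_trim F_blocks mean_trim; rewrite -/x !ler_norml; lra.
Qed.

Lemma almost_additive_in_lang p x : in_lang zeta x -> (q ^ p < size x)%N ->
  `|F x / (size x)%:R - block_mean p| <=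
  (2 * c + 4 * (q ^ p)%:R) / (size x)%:R + (`|discrepancy p| + c) / (q ^ p)%:R.
Proof.
move=> x_lang x_long; have x_gt0 : 0 < (size x)%:R :> R by rewrite ltr0n; lia.
have -> : F x / (size x)%:R - block_mean p =
    (F x - (size x)%:R * block_mean p) / (size x)%:R by field; rewrite gt_eqF.
rewrite normrM normfV (gtr0_norm x_gt0) ler_pdivrMr // mulrDl divfK ?gt_eqF //.
have [s [v [s' [x_eq]]]] := in_lang_decomposition q_gt1 size_zeta x_lang x_long.
rewrite -!(ler_nat R) => s_le s'_le.
have v_le : (size v)%:R * (q ^ p)%:R <= (size x)%:R :> R.
  by rewrite -natrM ler_nat x_eq !size_cat (size_subst_iter size_zeta); lia.
have blocks_le : (size v)%:R * (`|discrepancy p| + c) <=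
    (`|discrepancy p| + c) / (q ^ p)%:R * (size x)%:R.
  rewrite mulrAC ler_pdivlMr // mulrAC [leRHS]mulrC ler_wpM2r //.
  exact: addr_ge0.
rewrite {1 2}x_eq; apply: le_trans (almost_additive_blocks p s v s') _.
by rewrite lerD //; lra.
Qed.

Lemma is_cvg_almost_additive : contracting zeta q ->
  cvg (F x / (size x)%:R @[x --> long_words zeta]).
Proof.
move=> contr; apply: cauchy_cvg; apply: cauchy_exP => e e_gt0.
have e2_gt0 : 0 < e / 2 by lra.
have tail_cvg0 : (`|discrepancy p| + c) / (q ^ p)%:R @[p --> \oo] --> (0 : R).
  rewrite -[X in _ --> X]addr0; under eq_fun do rewrite mulrDl.
  apply: cvgD; first exact: cvg_discrepancy.
  by rewrite -(mulr0 c); apply: cvgMr qXV_cvg0.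
have [p tail_small] : exists p, (`|discrepancy p| + c) / (q ^ p)%:R < e / 2.
  have /cvgr0_norm_lt /(_ _ e2_gt0) [N _ /(_ N (leqnn N))] := tail_cvg0.
  by move=> /ltr_normlW; exists N.
have boundary_cvg0 : (2 * c + 4 * (q ^ p)%:R) / (size x)%:R
    @[x --> long_words zeta] --> (0 : R).
  rewrite -(mulr0 (2 * c + 4 * (q ^ p)%:R)); apply: cvgMr.
  exact: (cvg_comp _ _ cvg_size_long_words (@cvg_natV R)).
exists (block_mean p).
suff : \forall x \near long_words zeta,
    ball (block_mean p) e (F x / (size x)%:R) by [].
near=> x.
rewrite -ball_normE /= distrC.
apply: le_lt_trans (almost_additive_in_lang _ _) _.
- by near: x; exists 0%N.
- by near: x; exists (q ^ p).+1.
rewrite [ltRHS]splitr ltrD //; apply: ltr_normlW; near: x.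
exact: cvgr0_norm_lt.
Unshelve. all: by end_near.
Qed.

End WordStatistic.
End Substitution.

(** * Recurrence densities *)

Definition density (R : realType) (T : eqType) (k : nat) (x : seq T) : R :=
  (recurrences x k)%:R / (size x)%:R ^+ 2.

Lemma densityE (R : realType) (T : finType) k (x : seq T) :
  density R k x = \sum_(w : k.-tuple T) ((occ w x)%:R / (size x)%:R) ^+ 2.
Proof.
rewrite /density recurrencesE natr_sum mulr_suml.
by apply: eq_bigr => w _; rewrite natrX expr_div_n.
Qed.

Definition word_frequency (R : realType) (zeta : bool -> seq bool)
    (w : seq bool) : R :=
  lim ((fun x => (occ w x)%:R / (size x)%:R : R) @ long_words zeta).

Definition limit_density (R : realType) (zeta : bool -> seq bool)
    (k : nat) : R :=
  \sum_(w : k.-tuple bool) word_frequency R zeta w ^+ 2.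

Section LimitDensity.
Variables (R : realType) (zeta : bool -> seq bool) (q : nat).
Hypotheses (q_gt1 : (1 < q)%N) (size_zeta : forall b, size (zeta b) = q).
Hypothesis contr : contracting zeta q.
Local Notation s := (limit_density R zeta).

#[local] Instance long_words_proper : ProperFilter (long_words zeta) :=
  long_words_filter q_gt1 size_zeta.

Lemma cvg_word_frequency w :
  (occ w x)%:R / (size x)%:R @[x --> long_words zeta] -->
  word_frequency R zeta w.
Proof.
apply: (is_cvg_almost_additive q_gt1 size_zeta (c := (size w)%:R)) => //
  [x|x x'].
  by rewrite normr_nat ler_nat occ_le_size.
rewrite -natrD ger0_norm ?subr_ge0 ?ler_nat ?occ_cat_ge //.
by rewrite lerBlDl -natrD ler_nat occ_cat_le.
Qed.

Lemma sum_word_frequency k : (0 < k)%N ->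
  \sum_(w : k.-tuple bool) word_frequency R zeta w = 1.
Proof.
move=> k_gt0.
pose total x : R := \sum_(w : k.-tuple bool) (occ w x)%:R / (size x)%:R.
have total_cvg : total x @[x --> long_words zeta] -->
    \sum_(w : k.-tuple bool) word_frequency R zeta w.
  apply: cvg_big => [|w _]; first exact: add_continuous.
  exact: cvg_word_frequency.
have total_cvg1 : total x @[x --> long_words zeta] --> (1 : R).
  have invsize_cvg0 : (size x)%:R^-1 @[x --> long_words zeta] --> (0 : R).
    exact: (cvg_comp _ _ (cvg_size_long_words q_gt1 size_zeta) (@cvg_natV R)).
  have : 1 - k.-1%:R * (size x)%:R^-1 @[x --> long_words zeta] --> (1 : R).
    rewrite -[X in _ --> X]subr0 -(mulr0 k.-1%:R).
    by apply: cvgB; [exact: cvg_cst|exact: cvgMr].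
  apply: cvg_trans; apply: near_eq_cvg; exists k => x _ kx.
  have x_gt0 : 0 < (size x)%:R :> R by rewrite ltr0n; lia.
  rewrite /total -mulr_suml -natr_sum sum_occ //.
  have -> : ((size x).+1 - k = size x - k.-1)%N by lia.
  by rewrite natrB; [rewrite mulrBl divff ?gt_eqF|lia].
by rewrite -(cvg_lim (@Rhausdorff R) total_cvg); apply: cvg_lim total_cvg1.
Qed.

Lemma cvg_density k : density R k x @[x --> long_words zeta] --> s k.
Proof.
under eq_fun do rewrite densityE.
apply: cvg_big => [|w _]; first exact: add_continuous.
by rewrite expr2; apply: cvgM; exact: cvg_word_frequency.
Qed.

Lemma cvg_density_decrement k :
  density R k x - density R k.+1 x @[x --> long_words zeta] --> s k - s k.+1.
Proof. by apply: cvgB; exact: cvg_density. Qed.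

Lemma limit_density_nonincreasing : nonincreasing_seq s.
Proof.
apply/nonincreasing_seqP => k.
rewrite -subr_ge0; apply: (cvgr_to_ge (@cvg_density_decrement k)).
apply: nearW => x; rewrite subr_ge0 ler_wpM2r ?invr_ge0 ?sqr_ge0 // ler_nat.
exact: subset_leq_card (runsS_sub _ _ _).
Qed.

Lemma limit_density_gt0 k : 0 < s k.
Proof.
suff sS_gt0 : 0 < s k.+1.
  exact: lt_le_trans sS_gt0 (limit_density_nonincreasing _).
rewrite lt_def sumr_ge0 ?andbT => [|w _]; last exact: sqr_ge0.
apply/eqP => /psumr_eq0P sum_eq0.
have : \sum_(w : k.+1.-tuple bool) word_frequency R zeta w = 0.
  apply: big1 => w _; apply/eqP; rewrite -sqrf_eq0 sum_eq0 // => w' _.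
  exact: sqr_ge0.
by rewrite sum_word_frequency // => /eqP; rewrite oner_eq0.
Qed.

Lemma limit_density_convex k : (0 < k)%N -> s k.+1 - s k.+2 <= s k - s k.+1.
Proof.
move=> k_gt0; rewrite -subr_ge0.
have second_difference_cvg :
    density R k x - density R k.+1 x - (density R k.+1 x - density R k.+2 x)
    @[x --> long_words zeta] --> s k - s k.+1 - (s k.+1 - s k.+2).
  by apply: cvgB; exact: cvg_density_decrement.
apply: (cvgr_to_ge second_difference_cvg).
apply: nearW => x; rewrite /density -!mulrBl.
rewrite mulr_ge0 ?invr_ge0 ?sqr_ge0 //.
have := card_runs_convex (agree (onth x)) (size x) k_gt0.
by rewrite -!/(recurrences x _) -(ler_nat R) natrD natrM; lra.
Qed.

Lemma limit_density_renormalization k : s k.+1 <= q%:R * s (k * q)%N.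
Proof.
pose x p := subst_iter zeta p [:: false].
have x_cvg : x p @[p --> \oo] --> long_words zeta.
  exact: (cvg_subst_iter_long_words q_gt1 size_zeta).
have xS_cvg : x p.+1 @[p --> \oo] --> long_words zeta.
  exact: (cvg_comp _ _ (cvg_addnl 1) x_cvg).
have renorm_cvg : q%:R * density R (k * q) (x p.+1) - density R k.+1 (x p)
    @[p --> \oo] --> q%:R * s (k * q)%N - s k.+1.
  apply: cvgB (cvg_comp _ _ x_cvg (@cvg_density k.+1)).
  by apply: cvgMr (cvg_comp _ _ xS_cvg (@cvg_density (k * q))).
rewrite -subr_ge0; apply: (cvgr_to_ge renorm_cvg); apply: nearW => p.
have x_gt0 : 0 < (size (x p))%:R :> R.
  by rewrite ltr0n (size_block size_zeta) expn_gt0 ltnW.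
have q_gt0 : 0 < q%:R :> R by rewrite ltr0n ltnW.
rewrite subr_ge0 /density (size_flatten_map size_zeta (x p)) natrM.
rewrite ler_pdivrMr ?exprn_gt0 //.
set count : R := (recurrences (flatten _) _)%:R.
have -> : q%:R * (count / ((size (x p))%:R * q%:R) ^+ 2) *
    (size (x p))%:R ^+ 2 = count / q%:R.
  by field; rewrite !gt_eqF.
rewrite ler_pdivlMr // -natrM ler_nat mulnC.
exact: recurrences_flatten_map.
Qed.

Lemma cvg_limit_density_ratio : s k.+1 / s k @[k --> \oo] --> (1 : R).
Proof.
rewrite -cvg_shiftS.
apply: (@cvg_convex_doubling_ratio R (fun k => s k.+1) q%:R) => [k|||k] /=.
- exact: limit_density_gt0.
- by move=> k k' kk'; apply: limit_density_nonincreasing.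
- by apply/nonincreasing_seqP => k; exact: limit_density_convex.
apply: le_trans (limit_density_renormalization k.+1) _.
by rewrite ler_wpM2l //; apply: limit_density_nonincreasing; nia.
Qed.

End LimitDensity.

(** * Noncontracting substitutions *)

Lemma subst_iter_nseq zeta q (g : bool -> bool) a k :
  (forall b, zeta b = nseq q (g b)) ->
  subst_iter zeta k [:: a] = nseq (q ^ k) (iter k g a).
Proof.
move=> zetaE; elim: k => // k IH.
rewrite /subst_iter iterS -/(subst_iter _ _ _) IH expnSr.
elim: (q ^ k)%N => //= n IHn.
by rewrite /subst_word /= -/(subst_word _ _) IHn zetaE mulSn nseqD.
Qed.

Lemma not_contracting_nseq zeta q : (forall b, size (zeta b) = q) ->
  ~~ contracting zeta q -> exists g, forall b, zeta b = nseq q (g b).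
Proof.
move=> size_zeta; rewrite /contracting -leqNgt => q_le.
have nseq_true b : count_mem true (zeta b) = q -> zeta b = nseq q true.
  by rewrite -(size_zeta b) => /eqP; rewrite -all_count => /all_pred1P.
have nseq_false b : count_mem true (zeta b) = 0%N -> zeta b = nseq q false.
  move=> /count_memPn true_notin; rewrite -(size_zeta b).
  by apply/all_pred1P/allP => -[] // true_in; rewrite true_in in true_notin.
have count_le b : (count_mem true (zeta b) <= q)%N.
  by rewrite -(size_zeta b) count_size.
have := count_le true; have := count_le false.
have [count_incr|count_decr] :=
    leqP (count_mem true (zeta true)) (count_mem true (zeta false)).
  by exists negb; case; [apply: nseq_false|apply: nseq_true]; lia.
by exists id; case; [apply: nseq_true|apply: nseq_false]; lia.
Qed.

Lemma in_subshift_nseq_constant zeta q (g : bool -> bool) y :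
  (forall b, zeta b = nseq q (g b)) -> in_subshift zeta y ->
  forall i, y i = y 0%N.
Proof.
move=> zetaE y_lang i; have [a [k [_]]] := y_lang i.+1.
rewrite (subst_iter_nseq _ _ zetaE) => /mem_infix prefix_sub.
have y_eq j : (j <= i)%N -> y j = iter k g a.
  move=> ji; have : y j \in mkseq y i.+1 by rewrite map_f // mem_iota.
  by move/prefix_sub; rewrite mem_nseq => /andP[_ /eqP].
by rewrite !y_eq.
Qed.

Lemma constant_in_subshift q y : (1 < q)%N -> (forall i, y i = y 0%N) ->
  in_subshift (fun=> nseq q (y 0%N)) y.
Proof.
move=> q_gt1 y_const n; exists false, n.+1; split=> //.
rewrite (@subst_iter_nseq _ q (fun=> y 0%N)) //=.
have nq : (n <= q ^ n.+1)%N by rewrite ltnW // ltnW // ltn_expl.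
have -> : mkseq y n = nseq n (y 0%N).
  rewrite -[n in RHS](size_mkseq y n); apply/all_pred1P/allP => _ /mapP[i _ ->].
  exact/eqP.
by rewrite -(subnKC nq) nseqD prefix_infix.
Qed.

(* A noncontracting substitution permutes the constant words, so that [y] is
   constant and belongs to the subshift of a contracting substitution. *)
Lemma contracting_reduction zeta q y : (1 < q)%N ->
  (forall b, size (zeta b) = q) -> in_subshift zeta y ->
  exists zeta', [/\ forall b, size (zeta' b) = q, contracting zeta' q
    & in_subshift zeta' y].
Proof.
move=> q_gt1 size_zeta y_lang.
have [contr|] := boolP (contracting zeta q); first by exists zeta.
case/(not_contracting_nseq size_zeta) => g zetaE.
exists (fun=> nseq q (y 0%N)); split=> [b||]; first exact: size_nseq.
  by rewrite /contracting subrr ltnW.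
exact/constant_in_subshift/in_subshift_nseq_constant/y_lang.
Qed.

(** * The recurrence plot of the embedded sequence *)

Definition resolution (R : realType) (eps : R) : nat :=
  up_log 2 `|Num.ceil eps^-1|.

Lemma resolution_le (R : realType) (eps : R) h : 0 < eps ->
  (resolution eps <= h)%N = (2 ^- h <= eps).
Proof.
move=> eps_gt0.
have ceil_gt0 : 0 < Num.ceil eps^-1 by rewrite ceil_gt0 invr_gt0.
have -> : (2 ^- h <= eps) = (`|Num.ceil eps^-1| <= 2 ^ h)%N.
  rewrite invf_ple ?posrE ?exprn_gt0 // -lez_nat gtz0_abs // ceil_le_int.
  by rewrite -natrX.
apply/idP/idP => [|/up_log_min->//]; move/(leq_pexp2l (isT : 0 < 2)%N).
exact/leq_trans/up_logP.
Qed.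

(* The recurrence plot of [embed m y] at scale [eps] compares windows of [y] of
   this length, because each of the first [resolution eps] letters of a shift of
   [embed m y] is itself a window of length [m]. *)
Definition window_length (R : realType) (m : nat) (eps : R) : nat :=
  (resolution eps + m).-1.

Lemma resolution_gt0 (R : realType) (eps : R) :
  0 < eps < 1 -> (0 < resolution eps)%N.
Proof.
move=> /andP[eps_gt0 eps_lt1].
by rewrite ltnNge resolution_le // expr0 invr1 -ltNge.
Qed.

Lemma window_length_gt0 (R : realType) m (eps : R) :
  (0 < m)%N -> 0 < eps < 1 -> (0 < window_length m eps)%N.
Proof. by move=> m_gt0 /resolution_gt0; rewrite /window_length; lia. Qed.

Lemma cvg_window_length (R : realType) m : (0 < m)%N ->
  window_length m eps @[eps --> (0 : R)^'+] --> \oo.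
Proof.
move=> m_gt0; apply/cvgnyPge => h; near=> eps.
have eps_gt0 : 0 < eps by near: eps; exact: nbhs_right_gt.
suff : (h < resolution eps)%N by rewrite /window_length; lia.
rewrite ltnNge resolution_le // -ltNge; near: eps; apply: nbhs_right_lt.
by rewrite invr_gt0 exprn_gt0.
Unshelve. all: by end_near.
Qed.

Lemma rho_leP (R : realType) (T : eqType) (u v : nat -> T) (eps : R) :
  0 < eps ->
  reflect (forall t, (t < resolution eps)%N -> u t = v t) (rho R u v <= eps).
Proof.
move=> eps_gt0; rewrite /rho; case: pselect => [uv_differ|uv_agree]; last first.
  rewrite ltW //; apply: ReflectT => t _; apply/eqP/negPn/negP => uv_t.
  by apply: uv_agree; exists t.
case: ex_minnP => i uv_i i_min; rewrite -resolution_le //; apply: (iffP idP).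
  move=> i_large t t_small; apply/eqP/negPn/negP => /i_min; lia.
by move=> uv_eq; rewrite leqNgt; apply/negP => /uv_eq/eqP; apply/negP.
Qed.

Lemma rp_embed (R : realType) (y : nat -> bool) m (eps : R) i j : (0 < m)%N ->
  0 < eps < 1 ->
  rp (embed m y) eps i j = agree (embed (window_length m eps) y) i j.
Proof.
move=> m_gt0 eps01; have res_gt0 := resolution_gt0 eps01.
have /andP[eps_gt0 _] := eps01; rewrite /window_length.
apply/(rho_leP _ _ eps_gt0)/embed_eqP => [window_eq t tK|y_eq t t_res].
  have /eqP/embed_eqP := window_eq (minn t (resolution eps).-1) ltac:(lia).
  move=> /(_ (t - minn t (resolution eps).-1)%N ltac:(lia)).
  by rewrite -!addnA subnKC ?geq_minl.
apply/eqP/embed_eqP => r rm; rewrite -!addnA; apply: y_eq; lia.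
Qed.

(** * Determinism *)

Lemma is_lineE (R : realType) (T : eqType) (z : nat -> T) n (eps : R) l i j :
  (0 < l <= n)%N ->
  is_line z n eps i j l = is_maximal_run (offdiag (rp z eps)) n l i j.
Proof.
move=> /andP[l_gt0 ln].
rewrite /is_line /is_maximal_run is_run_offdiag // /offdiag eqn_add2r.
have [->|ij] := eqVneq i j; first by rewrite !andbF.
have -> : (0 < minn i j)%N ==> ~~ ((i.-1 != j.-1) && rp z eps i.-1 j.-1) =
    ((0 < minn i j)%N ==> ~~ rp z eps i.-1 j.-1).
  by case: posnP => //= min_gt0; rewrite (_ : i.-1 != j.-1) //; lia.
rewrite /is_run -!andbA /=; congr [&& _, _, _, _ & _ ==> _]; lia.
Qed.

Lemma Nlines_maximal_runs (R : realType) (T : eqType) (z : nat -> T) n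
    (eps : R) l :
  (0 < l <= n)%N ->
  Nlines z n eps l = #|maximal_runs (offdiag (rp z eps)) n l|.
Proof.
move=> l_n; apply: eq_card => -[i j]; rewrite [RHS]inE -is_lineE //=.
by rewrite unfold_in /in_set asboolb.
Qed.

Section Determinism.
Variables (R : realType) (T : eqType) (z : nat -> T) (n : nat) (eps : R).
Local Notation runs_count l := (#|runs (offdiag (rp z eps)) n l|%:R : R).

Lemma RR_runs l : RR z n eps l.+1 =
  (l.+1%:R * runs_count l.+1 - l%:R * runs_count l.+2) / ((n ^ 2)%:R - n%:R).
Proof.
rewrite /RR /lambda; under eq_bigr do rewrite mulrA.
rewrite -mulr_suml; congr (_ / _).
rewrite -[in X in X - _]natrM -(sum_length_maximal_runs _ _ (ltn0Sn l)).
rewrite natrD /= natrM addrK natr_sum !big_nat.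
apply: eq_bigr => k /andP[lk kn].
by rewrite natrM Nlines_maximal_runs //; lia.
Qed.

Lemma DET_runs l : (1 < n)%N ->
  DET l.+1 z n eps =
  (l.+1%:R * runs_count l.+1 - l%:R * runs_count l.+2) / runs_count 1.
Proof.
move=> n_gt1; rewrite /DET !RR_runs mul0r subr0 mul1r invf_div mulrA divfK //.
by rewrite subr_eq0 eqr_nat; apply/eqP; nia.
Qed.

End Determinism.

Section DeterminismLimit.
Variables (R : realType) (zeta : bool -> seq bool) (q : nat) (y : nat -> bool).
Hypotheses (q_gt1 : (1 < q)%N) (size_zeta : forall b, size (zeta b) = q).
Hypotheses (contr : contracting zeta q) (y_lang : in_subshift zeta y).
Local Notation s := (limit_density R zeta).

Let s_neq0 k : s k != 0.
Proof. by rewrite gt_eqF // (limit_density_gt0 R q_gt1 size_zeta contr). Qed.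

Lemma cvg_runs_embed K l : (0 < K)%N ->
  #|runs (offdiag (agree (embed K y))) n l.+1|%:R / n%:R ^+ 2 @[n --> \oo]
    --> s (K + l)%N.
Proof.
case: K => // K _; have agree_refl : reflexive (agree (embed K.+1 y)).
  by move=> i; exact: eqxx.
have density_cvg : density R (K + l).+1 (mkseq y (n + K)) @[n --> \oo]
    --> s (K + l).+1.
  have prefix_cvg : mkseq y (n + K) @[n --> \oo] --> long_words zeta.
    exact: (cvg_comp _ _ (cvg_addnr K) (cvg_prefix_long_words y_lang)).
  exact: (cvg_comp _ _ prefix_cvg (@cvg_density R _ _ q_gt1 size_zeta contr _)).
have dilation_cvg : 1 + K%:R * n%:R^-1 @[n --> \oo] --> (1 : R).
  rewrite -[X in _ --> X]addr0 -(mulr0 K%:R).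
  by apply: cvgD; [exact: cvg_cst|apply: cvgMr; exact: cvg_natV].
have diagonal_cvg0 : (n - l)%:R / n%:R ^+ 2 @[n --> \oo] --> (0 : R).
  apply: (squeeze_cvgr _ (cvg_cst (0 : R)) (@cvg_natV R)).
  exists 1%N => // n /= n_gt0; have nR_gt0 : 0 < n%:R :> R by rewrite ltr0n.
  rewrite divr_ge0 ?sqr_ge0 //= ler_pdivrMr ?exprn_gt0 //.
  by rewrite expr2 mulKf ?gt_eqF // ler_nat leq_subr.
have : density R (K + l).+1 (mkseq y (n + K)) *
      ((1 + K%:R * n%:R^-1) * (1 + K%:R * n%:R^-1)) - (n - l)%:R / n%:R ^+ 2
    @[n --> \oo] --> s (K + l).+1 * (1 * 1) - 0.
  by apply: cvgB diagonal_cvg0; apply: cvgM density_cvg _; exact: cvgM.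
rewrite !mulr1 subr0; apply: cvg_trans; apply: near_eq_cvg.
exists 1%N => // n /= n_gt0; have nR_gt0 : 0 < n%:R :> R by rewrite ltr0n.
have nK_gt0 : 0 < n%:R + K%:R :> R by rewrite ltr_pwDl.
rewrite /density size_mkseq -card_runs_embed.
rewrite -(card_runs_offdiag _ (ltn0Sn l) agree_refl) subSS !natrD.
by field; rewrite !gt_eqF.
Qed.

Definition det_limit l K : R :=
  (l.+1%:R * s (K + l)%N - l%:R * s (K + l).+1) / s K.

Lemma cvg_DET m l eps : (0 < m)%N -> 0 < eps < 1 ->
  DET l.+1 (embed m y) n eps @[n --> \oo]
    --> det_limit l (window_length m eps).
Proof.
move=> m_gt0 eps01; set K := window_length m eps.
have K_gt0 : (0 < K)%N by exact: window_length_gt0.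
pose run_density j n : R :=
  #|runs (offdiag (agree (embed K y))) n j.+1|%:R / n%:R ^+ 2.
have run_density_cvg j : run_density j n @[n --> \oo] --> s (K + j)%N.
  exact: cvg_runs_embed.
have : (l.+1%:R * run_density l n - l%:R * run_density l.+1 n) /
    run_density 0%N n @[n --> \oo] --> det_limit l K.
  apply: cvgM; last first.
    by apply: cvgV; [rewrite s_neq0|rewrite -[K in s K]addn0].
  by rewrite -addnS; apply: cvgB; apply: cvgMr; exact: run_density_cvg.
apply: cvg_trans; apply: near_eq_cvg; exists 2%N => // n /= n_gt1.
have n_gt0 : 0 < n%:R :> R by rewrite ltr0n; lia.
have plotE : offdiag (rp (embed m y) eps) =2 offdiag (agree (embed K y)).
  by move=> i j; rewrite /offdiag rp_embed.
rewrite DET_runs // !(eq_runs _ _ plotE) /run_density.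
rewrite !mulrA -mulrBl invf_div mulrA divfK //.
by rewrite expf_neq0 // gt_eqF.
Qed.

Lemma cvg_det_limit l : det_limit l K @[K --> \oo] --> (1 : R).
Proof.
have ratio_cvg : s K.+1 / s K @[K --> \oo] --> (1 : R).
  exact: (cvg_limit_density_ratio q_gt1 size_zeta contr).
have shifted_cvg j : s (K + j)%N / s K @[K --> \oo] --> (1 : R).
  exact: (cvg_ratio_shift j s_neq0 ratio_cvg).
have : l.+1%:R * (s (K + l)%N / s K) - l%:R * (s (K + l.+1)%N / s K)
    @[K --> \oo] --> (l.+1%:R * 1 - l%:R * 1 : R).
  by apply: cvgB; apply: cvgMr; exact: shifted_cvg.
have -> : l.+1%:R * 1 - l%:R * 1 = 1 :> R.
  by rewrite !mulr1 -natr1 addrAC subrr add0r.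
apply: cvg_trans; apply: near_eq_cvg; apply: nearW => K /=.
by rewrite /det_limit addnS mulrBl !mulrA.
Qed.

End DeterminismLimit.

Theorem theorem1p3 (R : realType) (zeta : bool -> seq bool) (q : nat)
    (hzeta : uniform_subst zeta q)
    (y : nat -> bool) (hy : in_subshift zeta y) (m l : nat)
    (hm : (1 <= m)%N) (hl : (1 <= l)%N) :
  (\forall eps \near (0 : R)^'+, cvg ((fun n => DET l (embed m y) n eps) @ \oo)) /\
  (fun eps : R => DETinf l (embed m y) eps) @ (0 : R)^'+ --> (1 : R).
Proof.
have [q_gt1 [size_false size_true]] := hzeta.
have size_zeta b : size (zeta b) = q by case: b.
have [xi [size_xi contr y_lang]] := contracting_reduction q_gt1 size_zeta hy.
case: l hl => // l _.
have eps01 : \forall eps \near (0 : R)^'+, 0 < eps < 1.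
  near=> eps; apply/andP; split; near: eps; first exact: nbhs_right_gt.
  exact: nbhs_right_lt.
have DET_cvg (eps : R) : 0 < eps < 1 ->
    DET l.+1 (embed m y) n eps @[n --> \oo]
    --> det_limit R xi l (window_length m eps).
  exact: (cvg_DET q_gt1 size_xi).
have det_limit_cvg1 : det_limit R xi l K @[K --> \oo] --> (1 : R).
  exact: (cvg_det_limit q_gt1 size_xi).
split; first by apply: filterS eps01 => eps /DET_cvg/cvgP.
have : det_limit R xi l (window_length m eps) @[eps --> (0 : R)^'+] --> (1 : R).
  exact: (cvg_comp _ _ (@cvg_window_length R m hm) det_limit_cvg1).
apply: cvg_trans; apply: near_eq_cvg; apply: filterS eps01 => eps /DET_cvg.
by move/(cvg_lim (@Rhausdorff R)).
Unshelve. all: by end_near.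
Qed.
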